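(* For any $n>0$ and $a\ge 0$, one has $$F_a(n)=\frac{(n-a-1)!}{a!}\sum_{\substack{\lambda\vdash n\\ |\lambda|-\ell(\lambda)\ge a}}\bigl(|\lambda|-\ell(\lambda)\bigr)_{a-1}\,M_\lambda .$$
   Context: For a partition $\lambda\vdash n$, $K_\lambda\in\mathbb{C}[\mathfrak{S}_n]$ is the sum of all permutations of cycle type $\lambda$, $|\lambda|=n$ is the size and $\ell(\lambda)$ the number of parts of $\lambda$, $p_\lambda$ is the power-sum symmetric function and $M_\lambda$ the monomial symmetric function. Let $\Lambda$ be the ring of symmetric functions, and let $\psi:\mathbb{C}[\mathfrak{S}_n]\to\Lambda$ be the linear map with $\psi(\sigma)=\frac{1}{n!}p_\lambda$ when $\sigma$ has cycle type $\lambda$. Define $F_a(n):=\psi\bigl(K_{(n)}\cdot K_{(n-a,1^a)}\bigr)$, where $(n-a,1^a)$ (for $0\le a<n$) is the partition with one part $n-a$ and $a$ parts equal to $1$. The falling power is $(x)_m=x(x-1)\cdots(x-m+1)$ for $m\ge 0$, and by convention $(x)_{-1}=\frac{1}{x+1}$.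
   Formalization: The case a = n-1 with n ≥ 2 is excluded, since there the printed identity fails (F_{n-1}(n) = p_n/n, but the right-hand side is M_(n)); a is taken with a < n, the range in which F_a(n) is defined. *)

(* Defs.v *)
From HB Require Import structures.
From mathcomp Require Import all_boot all_order all_algebra all_fingroup.
From mathcomp Require Import mpoly.
From mathcomp Require Import boolp.

Set Implicit Arguments.
Unset Strict Implicit.
Unset Printing Implicit Defensive.

Import GRing.Theory.
Local Open Scope ring_scope.

(* Weakly decreasing lists of positive integers with sum [n].  The parts and
   their number are at most [n], so bounded sequences over ['I_n.+1] suffice and
   give a finite type. *)
Definition is_intpartn (n : nat) (l : seq nat) : bool :=
  [&& sorted geq l, 0%N \notin l & sumn l == n].

Record intpartn (n : nat) := Intpartn {
  intpartn_bseq : n.-bseq 'I_n.+1;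
  intpartn_axiom : is_intpartn n (map val (bseqval intpartn_bseq))
}.

HB.instance Definition _ n := [isSub for @intpartn_bseq n].
HB.instance Definition _ n := [Finite of intpartn n by <:].

Definition parts n (l : intpartn n) : seq nat := map val (bseqval (intpartn_bseq l)).
Coercion parts : intpartn >-> seq.

Lemma intpartnP n (l : intpartn n) : is_intpartn n l.
Proof. exact: intpartn_axiom. Qed.

Lemma intpartn_exists n (l : seq nat) :
  is_intpartn n l -> exists p : intpartn n, parts p = l.
Proof.
move=> hl; have /and3P[_ l0 /eqP sl] := hl.
have le_n x : x \in l -> (x < n.+1)%N.
  by move=> xl; rewrite ltnS -sl sumnE (big_rem x xl) leq_addr.
have sz : (size (map (@inord n) l) <= n)%N.
  rewrite size_map -sl; elim: l l0 {hl sl le_n} => //= x l IH.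
  rewrite inE negb_or => /andP[x0 /IH]; case: x x0 => // x _ h.
  by rewrite addSn ltnS (leq_trans h) ?leq_addl.
have E : map val (map (@inord n) l) = l.
  rewrite -map_comp -[RHS]map_id; apply/eq_in_map => x xl /=.
  by rewrite inordK ?le_n.
by exists (@Intpartn n (Bseq sz) (eq_ind_r (is_intpartn n) hl E)).
Qed.

Section SymmetricFunctions.
Variable C : comNzRingType.

(* Specialization of the last variable to 0. *)
Definition mrestr (N : nat) : {mpoly C[N.+1]} -> {mpoly C[N]} :=
  mmap (@mpolyC N C) (fun i => if unlift ord_max i is Some j then 'X_j else 0).

HB.instance Definition _ N := GRing.RMorphism.on (@mrestr N).

Lemma mrestrZ N c (p : {mpoly C[N.+1]}) : mrestr (c *: p) = c *: mrestr p.
Proof. by rewrite /mrestr mmapZ mul_mpolyC. Qed.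

Lemma mrestrX N (m : 'X_{1..N.+1}) :
  mrestr 'X_[m] = if m ord_max == 0%N then
    'X_[[multinom m (lift ord_max i) | i < N]] else 0 :> {mpoly C[N]}.
Proof.
have liftE (i : 'I_N) : widen_ord (leqnSn N) i = lift ord_max i.
  by apply/val_inj; rewrite /= /bump leqNgt ltn_ord.
rewrite /mrestr mmapX /mmap1 big_ord_recr /= unlift_none.
case: eqP => [->|/eqP m0]; last by rewrite expr0n (negPf m0) mulr0.
rewrite expr0 mulr1 mpolyXE_id; apply: eq_bigr => i _.
by rewrite liftE liftK mnmE.
Qed.

Lemma mcoeff_mrestr N (p : {mpoly C[N.+1]}) (m : 'X_{1..N}) :
  (mrestr p)@_m = p@_(mnmwiden m).
Proof.
have -> : mrestr p = \sum_(k <- msupp p) p@_k *: mrestr 'X_[k].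
  rewrite {1}(mpolyE p) (raddf_sum (@mrestr N)).
  by apply: eq_bigr => k _; apply: mrestrZ.
rewrite [in RHS](mpolyE p) !raddf_sum /=; apply: eq_bigr => k _.
rewrite !mcoeffZ mrestrX mcoeffX; congr (_ * _).
have liftE (i : 'I_N) : widen_ord (leqnSn N) i = lift ord_max i.
  by apply/val_inj; rewrite /= /bump leqNgt ltn_ord.
case: eqP => k0; last first.
  rewrite mcoeff0; case: eqP => // E; case: k0.
  by rewrite E mnmwiden_ordmax.
rewrite mcoeffX; congr (nat_of_bool _)%:R; apply/eqP/eqP => [<-|->].
  apply/mnmP => i; case: (unliftP ord_max i) => [j ->|->].
    by rewrite -liftE mnmwiden_widen mnmE liftE.
  by rewrite mnmwiden_ordmax.
by apply/mnmP => i; rewrite mnmE -liftE mnmwiden_widen.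
Qed.

(* The limit, in graded rings, of the rings of symmetric polynomials in N
   variables: coherent families of bounded degree. *)
Definition coherent (f : forall N, {mpoly C[N]}) : Prop :=
  [/\ forall N, f N \is symmetric,
      forall N, mrestr (f N.+1) = f N
    & exists d, forall N, (msize (f N) <= d)%N].

Record symfun := SymFun {
  sf_poly :> forall N, {mpoly C[N]};
  sf_coherent : coherent sf_poly
}.

Lemma symfunP (f g : symfun) : (forall N, f N = g N) <-> f = g.
Proof.
split=> [fg|-> //].
case: f g fg => [f hf] [g hg] /= fg.
have E : f = g by apply: functional_extensionality_dep.
by case: _ / E hg => hg; congr SymFun; apply: Prop_irrelevance.
Qed.

HB.instance Definition _ := gen_eqMixin symfun.
HB.instance Definition _ := gen_choiceMixin symfun.

Fact coherentC c : coherent (fun N => c%:MP_[N]).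
Proof.
split=> [N|N|].
- by rewrite -[c%:MP]mulr1 mul_mpolyC rpredZ ?rpred1.
- by rewrite /mrestr mmapC.
- by exists 1%N => N; rewrite msizeC leq_b1.
Qed.

Fact coherentN (f : symfun) : coherent (fun N => - f N).
Proof.
case: f => f [fs fr [d fd]] /=; split=> [N|N|]; first by rewrite rpredN fs.
- by rewrite rmorphN /= fr.
- by exists d => N; rewrite msizeN.
Qed.

Fact coherentD (f g : symfun) : coherent (fun N => f N + g N).
Proof.
case: f g => [f [fs fr [d fd]]] [g [gs gr [e ge]]] /=.
split=> [N|N|]; first by rewrite rpredD ?fs ?gs.
- by rewrite rmorphD /= fr gr.
- exists (maxn d e) => N; apply: leq_trans (msizeD_le _ _) _.
  by rewrite geq_max !leq_max fd ge orbT.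
Qed.

Fact coherentM (f g : symfun) : coherent (fun N => f N * g N).
Proof.
case: f g => [f [fs fr [d fd]]] [g [gs gr [e ge]]] /=.
split=> [N|N|]; first by rewrite rpredM ?fs ?gs.
- by rewrite rmorphM /= fr gr.
- exists (d + e).+1 => N; apply: leq_trans (msizeM_le _ _) _.
  by rewrite ltnS leq_add.
Qed.

Fact coherentZ c (f : symfun) : coherent (fun N => c *: f N).
Proof.
case: f => f [fs fr [d fd]] /=; split=> [N|N|]; first by rewrite rpredZ ?fs.
- by rewrite mrestrZ fr.
- by exists d => N; rewrite (leq_trans (msizeZ_le _ _)).
Qed.

Definition sf_zero := SymFun (coherentC 0).
Definition sf_one := SymFun (coherentC 1).
Definition sf_opp f := SymFun (coherentN f).
Definition sf_add f g := SymFun (coherentD f g).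
Definition sf_mul f g := SymFun (coherentM f g).
Definition sf_scale c f := SymFun (coherentZ c f).

Fact sf_addA : associative sf_add.
Proof. by move=> f g h; apply/symfunP => N /=; rewrite addrA. Qed.
Fact sf_addC : commutative sf_add.
Proof. by move=> f g; apply/symfunP => N /=; rewrite addrC. Qed.
Fact sf_add0 : left_id sf_zero sf_add.
Proof. by move=> f; apply/symfunP => N /=; rewrite mpolyC0 add0r. Qed.
Fact sf_addN : left_inverse sf_zero sf_opp sf_add.
Proof. by move=> f; apply/symfunP => N /=; rewrite mpolyC0 addNr. Qed.

HB.instance Definition _ :=
  GRing.isZmodule.Build symfun sf_addA sf_addC sf_add0 sf_addN.

Fact sf_mulA : associative sf_mul.
Proof. by move=> f g h; apply/symfunP => N /=; rewrite mulrA. Qed.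
Fact sf_mulC : commutative sf_mul.
Proof. by move=> f g; apply/symfunP => N /=; rewrite mulrC. Qed.
Fact sf_mul1 : left_id sf_one sf_mul.
Proof. by move=> f; apply/symfunP => N /=; rewrite mpolyC1 mul1r. Qed.
Fact sf_mulDl : left_distributive sf_mul sf_add.
Proof. by move=> f g h; apply/symfunP => N /=; rewrite mulrDl. Qed.
Fact sf_one_neq0 : sf_one != sf_zero.
Proof.
apply/eqP => /symfunP/(_ 0%N)/eqP /=.
by rewrite mpolyC0 mpolyC1 oner_eq0.
Qed.

HB.instance Definition _ := GRing.Zmodule_isComNzRing.Build symfun
  sf_mulA sf_mulC sf_mul1 sf_mulDl sf_one_neq0.

Fact sf_scaleA a b f : sf_scale a (sf_scale b f) = sf_scale (a * b) f.
Proof. by apply/symfunP => N /=; rewrite scalerA. Qed.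
Fact sf_scale1 : left_id 1 sf_scale.
Proof. by move=> f; apply/symfunP => N /=; rewrite scale1r. Qed.
Fact sf_scaleDr : right_distributive sf_scale +%R.
Proof. by move=> c f g; apply/symfunP => N /=; rewrite scalerDr. Qed.
Fact sf_scaleDl f : {morph sf_scale^~ f : a b / a + b}.
Proof. by move=> a b; apply/symfunP => N /=; rewrite scalerDl. Qed.

HB.instance Definition _ := GRing.Zmodule_isLmodule.Build C symfun
  sf_scaleA sf_scale1 sf_scaleDr sf_scaleDl.

Fact sf_scaleAl c (f g : symfun) : c *: (f * g) = (c *: f) * g.
Proof. by apply/symfunP => N /=; rewrite scalerAl. Qed.

HB.instance Definition _ := GRing.Lmodule_isLalgebra.Build C symfun sf_scaleAl.
HB.instance Definition _ := GRing.Lalgebra_isComAlgebra.Build C symfun.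

Definition sf_eval N (f : symfun) : {mpoly C[N]} := f N.

Fact sf_eval_zmod N : zmod_morphism (@sf_eval N).
Proof. by []. Qed.
Fact sf_eval_monoid N : monoid_morphism (@sf_eval N).
Proof. by split=> //; apply: mpolyC1. Qed.
Fact sf_eval_scalable N : scalable (@sf_eval N).
Proof. by []. Qed.

HB.instance Definition _ N :=
  GRing.isZmodMorphism.Build symfun {mpoly C[N]} (@sf_eval N) (@sf_eval_zmod N).
HB.instance Definition _ N :=
  GRing.isMonoidMorphism.Build symfun {mpoly C[N]} (@sf_eval N)
    (sf_eval_monoid N).
HB.instance Definition _ N :=
  GRing.isScalable.Build C symfun {mpoly C[N]} *:%R (@sf_eval N)
    (@sf_eval_scalable N).

(* [k = 0] is a junk case, since the number of variables is not a coherent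
   family. *)
Definition psum_poly (k N : nat) : {mpoly C[N]} :=
  if k is 0%N then 1 else \sum_(i < N) 'X_i ^+ k.

Fact psum_coherent k : coherent (psum_poly k).
Proof.
case: k => [|k].
  case: (coherentC 1) => hs hr hd; split.
  - by move=> N; rewrite rpred1.
  - by move=> N; rewrite /= rmorph1.
  - by exists 1%N => N; rewrite /= -mpolyC1 msizeC leq_b1.
split=> [N|N|].
- apply/issymP => s; rewrite raddf_sum /=.
  rewrite [RHS](reindex_inj (@perm_inj _ s)) /=; apply: eq_bigr => i _.
  by rewrite rmorphXn /= /msym mmapX mmap1U.
- rewrite /= rmorph_sum big_ord_recr /= [X in _ + X]rmorphXn /=.
  rewrite {2}/mrestr mmapX mmap1U unlift_none expr0n addr0.
  apply: eq_bigr => i _; rewrite rmorphXn /= /mrestr mmapX mmap1U.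
  have -> : widen_ord (leqnSn N) i = lift ord_max i.
    by apply/val_inj; rewrite /= /bump leqNgt ltn_ord.
  by rewrite liftK.
- exists k.+2 => N /=; apply: (big_ind (fun p => msize p <= k.+2)%N).
  + by rewrite msize0.
  + move=> p q hp hq; apply: leq_trans (msizeD_le _ _) _.
    by rewrite geq_max hp hq.
  + by move=> i _; rewrite mpolyXn msizeX mdegMn mdeg1 mul1n.
Qed.

Definition psum k := SymFun (psum_coherent k).

Definition powersum (l : seq nat) : symfun := \prod_(k <- l) psum k.

(* The sum of all monomials whose multiset of nonzero exponents is [l]; such
   monomials have degree [sumn l], whence the finite range of summation. *)
Definition monomial_poly (l : seq nat) (N : nat) : {mpoly C[N]} :=
  \sum_(m : 'X_{1..N < (sumn l).+1} | perm_eq [seq k <- val m | k != 0%N] l)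
    'X_[m].

Lemma mcoeff_monomial_poly l N (m : 'X_{1..N}) :
  (monomial_poly l N)@_m = (perm_eq [seq k <- m | k != 0%N] l)%:R.
Proof.
rewrite /monomial_poly raddf_sum /=.
under eq_bigr do rewrite mcoeffX.
case: (boolP (perm_eq _ _)) => hm; last first.
  rewrite big1 // => k hk; case: eqP => // E.
  by rewrite -E hk in hm.
have dm : (mdeg m < (sumn l).+1)%N.
  rewrite ltnS /mdeg -(perm_sumn hm) sumnE big_filter [leqRHS]big_mkcond /=.
  by apply: leq_sum => i _; case: eqP => // ->.
rewrite (bigD1 (BMultinom dm)) //= eqxx big1 ?addr0 // => k /andP[_ /eqP hk].
by case: eqP => // E; case: hk; apply/val_inj.
Qed.

Fact monomial_coherent l : coherent (monomial_poly l).
Proof.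
split=> [N|N|].
- apply/issymP => s; apply/mpolyP => m; rewrite mcoeff_sym.
  rewrite !mcoeff_monomial_poly; congr (nat_of_bool _)%:R.
  apply: permPl; apply: perm_filter; apply/tuple_permP.
  by exists s.
- apply/mpolyP => m; rewrite mcoeff_mrestr !mcoeff_monomial_poly.
  by rewrite /= filter_rcons.
- exists (sumn l).+1 => N; rewrite /monomial_poly.
  apply: (big_ind (fun p => msize p <= (sumn l).+1)%N).
  + by rewrite msize0.
  + move=> p q hp hq; apply: leq_trans (msizeD_le _ _) _.
    by rewrite geq_max hp hq.
  + by move=> m _; rewrite msizeX bmdeg.
Qed.

Definition monomial l := SymFun (monomial_coherent l).

End SymmetricFunctions.

Arguments psum C k : clear implicits.
Arguments powersum C l : clear implicits.
Arguments monomial C l : clear implicits.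

Section GroupAlgebra.
Variables (C : comNzRingType) (gT : finGroupType).

(* Not [{ffun gT -> C}] itself, which carries the pointwise product. *)
Definition galg := {ffun gT -> C}.

HB.instance Definition _ := GRing.Lmodule.copy galg {ffun gT -> C^o}.

Definition gelt (x : gT) : galg := [ffun y => (y == x)%:R].

Definition galg_mul (f g : galg) : galg :=
  [ffun x => \sum_y f y * g (y^-1 * x)%g].

Fact galg_mulA : associative galg_mul.
Proof.
move=> f g h; apply/ffunP => x; rewrite !ffunE.
under eq_bigr do rewrite ffunE big_distrr /=.
under [RHS]eq_bigr do rewrite ffunE big_distrl /=.
rewrite [RHS]exchange_big /=; apply: eq_bigr => y _.
rewrite [RHS](reindex_inj (mulgI y)) /=; apply: eq_bigr => z _.
by rewrite mulrA mulKg invMg mulgA.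
Qed.

Fact galg_mul1 : left_id (gelt 1%g) galg_mul.
Proof.
move=> f; apply/ffunP => x; rewrite ffunE (bigD1 1%g) //= !ffunE eqxx mul1r.
rewrite invg1 mul1g big1 ?addr0 // => y /negPf y1.
by rewrite ffunE y1 mul0r.
Qed.

Fact galg_mulr1 : right_id (gelt 1%g) galg_mul.
Proof.
move=> f; apply/ffunP => x; rewrite ffunE (bigD1 x) //= ffunE mulVg eqxx mulr1.
rewrite big1 ?addr0 // => y yx.
rewrite ffunE -eq_mulVg1 (negPf yx) mulr0.
by [].
Qed.

Fact galg_mulDl : left_distributive galg_mul +%R.
Proof.
move=> f g h; apply/ffunP => x; rewrite !ffunE -big_split /=.
by apply: eq_bigr => y _; rewrite ffunE mulrDl.
Qed.

Fact galg_mulDr : right_distributive galg_mul +%R.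
Proof.
move=> f g h; apply/ffunP => x; rewrite !ffunE -big_split /=.
by apply: eq_bigr => y _; rewrite ffunE mulrDr.
Qed.

Fact gelt1_neq0 : gelt 1%g != 0.
Proof.
by apply/eqP => /ffunP/(_ 1%g)/eqP; rewrite !ffunE eqxx oner_eq0.
Qed.

HB.instance Definition _ := GRing.Zmodule_isNzRing.Build galg
  galg_mulA galg_mul1 galg_mulr1 galg_mulDl galg_mulDr gelt1_neq0.

Fact galg_scaleAl c (f g : galg) : c *: (f * g) = (c *: f) * g.
Proof.
apply/ffunP => x; rewrite !ffunE scaler_sumr.
by apply: eq_bigr => y _; rewrite ffunE scalerAl.
Qed.

HB.instance Definition _ := GRing.Lmodule_isLalgebra.Build C galg galg_scaleAl.

Fact galg_scaleAr c (f g : galg) : c *: (f * g) = f * (c *: g).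
Proof.
apply/ffunP => x; rewrite !ffunE scaler_sumr.
by apply: eq_bigr => y _; rewrite ffunE scalerAr.
Qed.

HB.instance Definition _ := GRing.Lalgebra_isAlgebra.Build C galg galg_scaleAr.

Lemma geltM x y : gelt x * gelt y = gelt (x * y)%g.
Proof.
apply/ffunP => z; rewrite !ffunE (bigD1 x) //= !ffunE eqxx mul1r.
rewrite big1 ?addr0 => [|t /negPf tx]; last by rewrite ffunE tx mul0r.
by rewrite -(inj_eq (mulgI x)) mulKVg.
Qed.

Lemma galgE (f : galg) : f = \sum_x f x *: gelt x.
Proof.
apply/ffunP => x; rewrite sum_ffunE (bigD1 x) //= !ffunE eqxx.
rewrite [_ *: _]mulr1 big1 ?addr0 // => y yx.
by rewrite !ffunE eq_sym (negPf yx) [_ *: _]mulr0.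
Qed.

End GroupAlgebra.

Definition cycle_type n (s : 'S_n) : seq nat :=
  sort geq [seq #|X| | X : {set 'I_n} in porbits s].

Definition class_sum (C : comNzRingType) n (l : seq nat) : galg C 'S_n :=
  \sum_(s : 'S_n | cycle_type s == l) gelt C s.

Section Psi.
Variables (C : fieldType) (n : nat).

Definition psi (f : galg C 'S_n) : symfun C :=
  \sum_(s : 'S_n) f s *: ((n`!)%:R^-1 *: powersum C (cycle_type s)).

Fact psi_is_linear : linear psi.
Proof.
move=> c f g; rewrite /psi scaler_sumr -big_split /=; apply: eq_bigr => s _.
rewrite [c *: (f s *: _)]scalerA -scalerDl; congr (_ *: _).
by rewrite !ffunE.
Qed.

HB.instance Definition _ :=
  GRing.isLinear.Build C (galg C 'S_n) (symfun C) *:%R psi psi_is_linear.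

Lemma psi_gelt s : psi (gelt C s) = (n`!)%:R^-1 *: powersum C (cycle_type s).
Proof.
rewrite /psi (bigD1 s) //= ffunE eqxx scale1r big1 ?addr0 // => t /negPf ts.
by rewrite ffunE ts scale0r.
Qed.

End Psi.

Definition hook_type (n a : nat) : seq nat := (n - a)%N :: nseq a 1%N.

Lemma hook_type_partn n a : (a < n)%N -> is_intpartn n (hook_type n a).
Proof.
move=> an; apply/and3P; split.
- have ones k : path geq 1%N (nseq k 1%N) by elim: k.
  by case: a an => //= a an; rewrite ones subn_gt0 an.
- rewrite inE negb_or eq_sym -lt0n subn_gt0 an /=.
  by apply/negP => /nseqP[].
- by rewrite /= sumn_nseq mul1n subnK // ltnW.
Qed.

(* For [a = n - 1] the second factor is the class sum of [(1^n)], i.e. the unit,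
   and [Fa C a n] is [p_n / n]. *)
Definition Fa (C : fieldType) (a n : nat) : symfun C :=
  psi (class_sum C n [:: n] * class_sum C n (hook_type n a)).

(* The falling power [(x)_m] for an integer [m], with
   [(x)_(-k) = 1 / ((x + 1) ... (x + k))]. *)
Definition falling (C : fieldType) (x : C) (m : int) : C :=
  match m with
  | Posz k => \prod_(i < k) (x - i%:R)
  | Negz k => (\prod_(i < k.+1) (x + i.+1%:R))^-1
  end.

(* Main.v *)
Require Import Defs.
From HB Require Import structures.
From mathcomp Require Import all_boot all_order all_algebra all_fingroup.
From mathcomp Require Import mpoly.
From mathcomp Require Import reals complex.
From mathcomp Require Import zify.

Set Implicit Arguments.
Unset Strict Implicit.
Unset Printing Implicit Defensive.

Import GRing.Theory.
Local Open Scope ring_scope.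

(* The coefficient of F_a(n) at a monomial x^m is 1/n! times the number of
   triples (s, t, f) where s is an n-cycle, t is an (n-a)-cycle and f is a
   colouring of {0..n-1} with m_v points of each colour v such that
   f o s = f o t.  Fix f, with l colours, and t.  The permutations s with
   f o s = f o t and s an n-cycle are the Eulerian tours of the directed graph
   on the colours with an edge f z -> f (t z) for each z, so the BEST theorem
   counts them by arborescences: choices of one edge e v out of each non-root
   colour v.  Exchanging the sums, one counts for fixed e and fixed support A of
   size k = n-a the k-cycles t on A for which e is an arborescence; contracting
   the edges of e one at a time shows that a proportion lam_w / (k-l+1) of the
   (k-1)! cycles qualifies, lam_w being the number of points of A of the root
   colour w.  Summing over A gives a binomial coefficient. *)

(** * Cycles supported on a set *)

Section CyclesOnSets.
Local Open Scope nat_scope.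
Variable T : finType.
Implicit Types (A : {set T}) (s : {perm T}) (c x y : T).

(** Singletons are allowed: the only cycle on a one-point set is the identity. *)
Definition cyclic_on A s := perm_on A s && (A \in porbits s).

Lemma porbit_fixed s x : s x = x -> porbit s x = [set x].
Proof.
move=> sx; apply/setP => y; rewrite inE; apply/porbitP/eqP => [[i ->]|->].
  by elim: i => [|i IH]; rewrite ?perm1 // expgSr permM IH.
by exists 0; rewrite perm1.
Qed.

Lemma porbit_sub_on A s x : perm_on A s -> x \in A -> porbit s x \subset A.
Proof.
move=> sA xA; apply/subsetP => y /porbitP[i ->].
by elim: i => [|i IH]; rewrite ?perm1 // expgSr permM perm_closed.
Qed.

(** The points outside [A] are singleton orbits, so [A] is a single orbit exactly when the orbits
    number one more than those points. An orbit count is easy to follow under multiplication by a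
    transposition. *)
Lemma cyclic_onE A s : cyclic_on A s =
  [&& A != set0, perm_on A s & #|porbits s| + #|A| == #|T|.+1].
Proof.
rewrite /cyclic_on; case: (boolP (perm_on A s)) => sA; last by rewrite andbF.
have -> : porbits s = [set porbit s x | x in A] :|: [set [set x] | x in ~: A].
  apply/setP => B; apply/imsetP/setUP => [[x _ ->]|[]/imsetP[x xA ->]].
  - have [xA|xA] := boolP (x \in A); [left|right]; apply/imsetP; exists x => //.
      by rewrite inE.
    by rewrite porbit_fixed ?(out_perm sA).
  - by exists x.
  - by exists x; rewrite // porbit_fixed // (out_perm sA) // -in_setC.
have dis : [disjoint [set porbit s x | x in A] & [set [set x] | x in ~: A]].
  rewrite -setI_eq0; apply/eqP/setP => B; rewrite !inE.
  apply/andP => -[/imsetP[x xA ->] /imsetP[y yA E]].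
  have := porbit_id s x; rewrite E inE => /eqP xy.
  by move: yA; rewrite inE -xy xA.
have := leq_card_setU [set porbit s x | x in A] [set [set x] | x in ~: A].
move=> [_]; rewrite dis => /eqP ->.
rewrite (card_imset _ set1_inj) -addnA (addnC #|~: A|) cardsC addnC.
rewrite -[in RHS]addn1 eqn_add2l /= inE.
have -> : (A \in [set [set x] | x in ~: A]) = false.
  apply/imsetP => -[x xA E]; have : x \in A by rewrite E inE.
  by move: xA; rewrite inE => /negP.
rewrite orbF; apply/imsetP/andP => [[x xA E]|[/set0Pn[x xA] /cards1P[B E]]].
  split; first by apply/set0Pn; exists x.
  apply/cards1P; exists A; apply/setP => B; rewrite inE.
  apply/imsetP/eqP => [[y yA ->]|->]; last by exists x.
  by rewrite [RHS]E; apply/eqP; rewrite eq_porbit_mem -E.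
have EB y : y \in A -> porbit s y = B.
  by move=> yA; apply/set1P; rewrite -E imset_f.
exists x => //; apply/eqP; rewrite eqEsubset (porbit_sub_on sA) // andbT.
by apply/subsetP => y yA; rewrite EB // -(EB y yA) porbit_id.
Qed.

Lemma cyclic_onV A s : cyclic_on A s^-1%g = cyclic_on A s.
Proof.
rewrite /cyclic_on porbitsV; congr andb.
by apply/idP/idP => /perm_onV; rewrite ?invgK.
Qed.

Lemma cyclic_on_tpermL A s c y : y \in A -> c \in A -> y != c ->
  cyclic_on A (tperm y c * s)%g && ((tperm y c * s)%g y == c) =
  cyclic_on (A :\ c) s.
Proof.
move=> yA cA yc; rewrite permM tpermL.
have onc : perm_on A (tperm y c * s)%g%g && (s c == c) = perm_on (A :\ c) s.
  have tA : perm_on A (tperm y c).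
    apply/subsetP => z; rewrite inE => zt; have := subsetP (tperm_on y c) z.
    by rewrite inE zt => /(_ isT); rewrite !inE => /orP[]/eqP->.
  apply/andP/idP => [[tsA /eqP sc]|sAc].
    have sA : perm_on A s by rewrite -(mulKg (tperm y c) s) tpermV perm_onM.
    apply/subsetP => z; rewrite inE => zs; rewrite !inE (subsetP sA) ?inE //.
    by rewrite andbT; apply: contraNneq zs => ->; rewrite sc.
  split; last by rewrite (out_perm sAc) ?inE ?eqxx.
  by apply: perm_onM => //; apply: subset_trans sAc (subsetDl _ _).
have An : A != set0 by apply/set0Pn; exists c.
have Acn : A :\ c != set0 by apply/set0Pn; exists y; rewrite !inE yc.
rewrite !cyclic_onE -onc An Acn /=; case: (s c =P c) => sc; rewrite ?andbF ?andbT //.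
congr andb.
have := porbits_mul_tperm s y c; rewrite /= (porbit_fixed sc) !inE yc.
rewrite (cardsD1 c A) cA /=; lia.
Qed.

(** Here [c] is inserted right before [y]; this is the previous lemma for inverses. *)
Lemma cyclic_on_tpermR A s c y : y \in A -> c \in A -> y != c ->
  cyclic_on A (s * tperm c y)%g && ((s * tperm c y)%g c == y) =
  cyclic_on (A :\ c) s.
Proof.
move=> yA cA yc; rewrite -cyclic_onV -[RHS]cyclic_onV invMg tpermV tpermC.
rewrite -(cyclic_on_tpermL _ yA) //; congr andb.
rewrite !permM tpermL tpermC (can2_eq (tpermK c y) (tpermK c y)) tpermR.
by rewrite (can2_eq (permK s) (permKV s)) eq_sym.
Qed.

Lemma cyclic_on1 x : cyclic_on [set x] 1.
Proof.
rewrite /cyclic_on perm_on1 /=; apply/imsetP; exists x => //.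
by rewrite porbit_fixed ?perm1.
Qed.

Lemma cyclic_on_set1 x s : cyclic_on [set x] s = (s == 1%g).
Proof.
apply/idP/eqP => [/andP[sx _]|->]; last exact: cyclic_on1.
by apply: perm_on_id sx _; rewrite cards1.
Qed.

Lemma cyclic_on_neq A s x : cyclic_on A s -> x \in A -> 1 < #|A| -> s x != x.
Proof.
move=> /andP[_ /imsetP[y _ ->]] xy; apply: contraTneq => sx.
move: xy; rewrite porbit_sym porbit_fixed // => /set1P->.
by rewrite porbit_fixed // cards1.
Qed.

Lemma cyclic_on_closed A s x : cyclic_on A s -> (s x \in A) = (x \in A).
Proof. by move=> /andP[/perm_closed]. Qed.

(** Cycles are sorted by the successor [y] of [c], and [c] itself is deleted. *)
Lemma sum_cyclic_onR A c (F : {perm T} -> nat) : c \in A -> 1 < #|A| ->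
  \sum_(s | cyclic_on A s) F s =
  \sum_(y in A :\ c) \sum_(s | cyclic_on (A :\ c) s) F (s * tperm c y)%g.
Proof.
move=> cA A1.
rewrite (partition_big (fun s : {perm T} => s c) (mem (A :\ c))) /=; last first.
  by move=> s sA; rewrite !inE (cyclic_on_neq sA) // (cyclic_on_closed _ sA).
apply: eq_bigr => y /setD1P[yc yA].
rewrite (reindex_inj (mulIg (tperm c y))) /=; apply: eq_bigl => s.
exact: cyclic_on_tpermR.
Qed.

(** Cycles are again sorted by the successor [y] of [x], but now [y] is the point deleted. *)
Lemma sum_cyclic_onL A x (F : {perm T} -> nat) : x \in A -> 1 < #|A| ->
  \sum_(s | cyclic_on A s) F s =
  \sum_(y in A :\ x) \sum_(s | cyclic_on (A :\ y) s) F (tperm x y * s)%g.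
Proof.
move=> xA A1.
rewrite (partition_big (fun s : {perm T} => s x) (mem (A :\ x))) /=; last first.
  by move=> s sA; rewrite !inE (cyclic_on_neq sA) // (cyclic_on_closed _ sA).
apply: eq_bigr => y /setD1P[yx yA].
rewrite (reindex_inj (mulgI (tperm x y))) /=; apply: eq_bigl => s.
by apply: cyclic_on_tpermL; rewrite // eq_sym.
Qed.

Lemma card_cyclic_on A : A != set0 ->
  \sum_(s | cyclic_on A s) 1 = (#|A|.-1)`!.
Proof.
have [k] := ubnP #|A|; elim: k A => // k IH A Ak /set0Pn[c cA].
have [A1|A1] := leqP #|A| 1.
  have -> : A = [set c].
    by apply/eqP; rewrite eq_sym eqEcard sub1set cA cards1.
  by rewrite cards1; under eq_bigl do rewrite cyclic_on_set1; rewrite big_pred1_eq.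
rewrite (sum_cyclic_onR _ cA) //.
have cD : #|A| = #|A :\ c|.+1 by rewrite (cardsD1 c A) cA.
under eq_bigr => y yA.
  rewrite IH; [over | by lia |]; apply/set0Pn; exists y => //.
rewrite sum_nat_const cD /=.
by move: A1; rewrite cD; case: #|A :\ c|.
Qed.

End CyclesOnSets.

(** * Arborescences and Eulerian tours *)

Section Arborescences.
Local Open Scope nat_scope.
Variable V : finType.
Implicit Types (U W : {set V}) (u v w : V) (h : V -> V).

(* Every vertex of [W] reaches the root [w] by iterating [h]: a set that
   contains [w] and is closed under [h]-preimages must contain [W]. *)
Definition arborescence W w h := [forall U : {set V},
  (w \in U) ==> [forall v in W, (h v \in U) ==> (v \in U)] ==> (W \subset U)].

Lemma arborescenceP W w h :
  reflect (forall U, w \in U -> {in W, forall v, h v \in U -> v \in U} ->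
             W \subset U)
          (arborescence W w h).
Proof.
apply: (iffP forallP) => [a U wU cU|a U].
  have /implyP/(_ wU)/implyP := a U; apply.
  by apply/forall_inP => v vW; apply/implyP/cU.
apply/implyP => wU; apply/implyP => /forall_inP cU; apply: a => // v vW.
exact/implyP/cU.
Qed.

(** The sets tested contain [w] anyway, so closure at the root says nothing. *)
Lemma eq_arborescence W w h h' : {in W, forall v, v != w -> h v = h' v} ->
  arborescence W w h = arborescence W w h'.
Proof.
move=> E; apply/arborescenceP/arborescenceP => a U wU cU; apply: a => // v vW.
  by have [->|vw] := eqVneq v w; rewrite ?wU // E //; apply: cU.
by have [->|vw] := eqVneq v w; rewrite ?wU // -E //; apply: cU.
Qed.

Lemma arborescence_set1 w h : arborescence [set w] w h.
Proof. by apply/arborescenceP => U wU _; rewrite sub1set. Qed.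

Lemma arborescence_loop W w h v :
  v \in W -> v != w -> h v = v -> arborescence W w h = false.
Proof.
move=> vW vw hv; apply/arborescenceP => /(_ [set~ v]).
rewrite !inE eq_sym vw => /(_ isT) a.
have /subsetP/(_ v vW) : W \subset [set~ v].
  apply: a => z _; rewrite !inE; apply: contraNneq => ->; exact/eqP.
by rewrite !inE eqxx.
Qed.

(** Edges into [v] are redirected along the edge out of [v]. Closed sets before and after correspond
    once [v] is put in exactly when [h v] is. *)
Lemma arborescence_contract W w h v :
    v \in W -> v != w -> h v != v -> h v \in W ->
  arborescence W w h =
  arborescence (W :\ v) w (fun z => if h z == v then h v else h z).
Proof.
move=> vW vw hv hW; apply/arborescenceP/arborescenceP => a U wU cU.
- pose U' := if h v \in U then v |: U else U :\ v.
  have U'E z : z != v -> (z \in U') = (z \in U).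
    by rewrite /U'; case: ifP => _; rewrite !inE => /negPf->.
  have U'v : (v \in U') = (h v \in U).
    by rewrite /U'; case: ifP; rewrite !inE eqxx.
  have /subsetP sW : W \subset U'.
    apply: a => [|z zW]; first by rewrite U'E // eq_sym.
    have [->|zv] := eqVneq z v; first by rewrite U'v U'E.
    rewrite (U'E z) // => hz; apply: cU; first by rewrite !inE zv.
    by case: eqP hz => [->|/eqP hzv]; rewrite ?U'v ?(U'E _ hzv).
  by apply/subsetP => z /setD1P[zv /sW]; rewrite U'E.
- have /subsetP sW : W :\ v \subset U.
    apply: a => // z /setD1P[zv zW]; case: eqP => [E|_] hU; last exact: cU.
    by apply: (cU) => //; rewrite E; apply: cU.
  apply/subsetP => z zW; have [->|zv] := eqVneq z v; last by rewrite sW ?inE ?zv.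
  by apply: cU => //; rewrite sW ?inE ?hv.
Qed.

End Arborescences.

(** * Counting the cycles for which prescribed edges form an arborescence *)

Section EulerianTours.
Local Open Scope nat_scope.
Variables T V : finType.
Implicit Types (A : {set T}) (f g : T -> V) (x y z : T) (u v w : V).

Definition fiber A f v := [set z in A | f z == v].

Lemma card_fiberD1 A f v y : y \in A ->
  #|fiber A f v| = (f y == v) + #|fiber (A :\ y) f v|.
Proof.
move=> yA; rewrite (cardsD1 y) inE yA /=; congr (_ + #|pred_of_set _|).
by apply/setP => z; rewrite !inE andbA.
Qed.

Lemma eq_fiber A f g v : {in A, f =1 g} -> fiber A f v = fiber A g v.
Proof.
move=> E; apply/setP => z; rewrite !inE.
by case: (boolP (z \in A)) => // /E ->.
Qed.

Lemma fiber_imset A f v : (v \in f @: A) = (fiber A f v != set0).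
Proof.
apply/imsetP/set0Pn => [[z zA ->]|[z]]; first by exists z; rewrite inE zA /=.
by rewrite inE => /andP[zA /eqP <-]; exists z.
Qed.

(* Contracting the edge out of some [v != w] deletes [e v] from the cycle and
   gives the colour [v] that of the successor of [e v]. *)
Lemma card_cyclic_arborescence A (W : {set V}) w f (e : V -> T) :
    A != set0 -> w \in W -> {in A, forall z, f z \in W} ->
    {in W, forall v, v != w -> e v \in fiber A f v} ->
  (\sum_(s | cyclic_on A s) arborescence W w (fun v => f (s (e v)))) *
    (#|A| - #|W|).+1 = #|fiber A f w| * (#|A|.-1)`!.
Proof.
have [n] := ubnP #|W|; elim: n A W f => // n IH A W f Wn A0 wW fW eW.
have [/eqP WE|/set0Pn[v /setD1P[vw vW]]] := boolP (W :\ w == set0).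
  have {}WE : W = [set w] by rewrite -(setD1K wW) WE setU0.
  rewrite (eq_bigr (fun=> 1)) => [|s _]; last by rewrite WE arborescence_set1.
  rewrite card_cyclic_on // WE cards1 mulnC -subSn ?card_gt0 // subn1 /=.
  congr (_ * _); apply: eq_card => z; rewrite !inE.
  by case: (boolP (z \in A)) => // /fW; rewrite WE inE.
have := eW v vW vw; rewrite inE; set c := e v => /andP[cA /eqP fc].
have cD : #|A| = #|A :\ c|.+1 by rewrite (cardsD1 c A) cA.
(* If [c] is the only point, the edge out of [v] is a loop and no point has the root colour: both
   sides vanish. *)
have [A1|A1] := leqP #|A| 1.
  have E : A = [set c].
    by apply/eqP; rewrite eq_sym eqEcard sub1set cA cards1.
  rewrite big1 => [|s]; last first.
    rewrite E cyclic_on_set1 => /eqP ->.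
    by rewrite (arborescence_loop vW vw) // perm1.
  rewrite E (_ : fiber _ _ _ = set0) ?cards0 //.
  apply/setP => z; rewrite !inE; apply/negbTE/negP => /andP[/eqP -> /eqP fw].
  by rewrite -fc fw eqxx in vw.
pose L := #|fiber (A :\ c) f v|.
(* The contribution of the cycles sending [c] to [y]. If [y] has colour [v], the edge out of [v] is
   a loop; otherwise it is contracted, and the root gains the [L] remaining points of colour [v]
   exactly when [y] has the root colour. *)
have step y : y \in A :\ c ->
  (\sum_(s | cyclic_on (A :\ c) s)
     arborescence W w (fun v => f ((s * tperm c y)%g (e v)))) * (#|A| - #|W|).+1
  = if f y == v then 0
    else (#|fiber A f w| + (f y == w) * L) * (#|A|.-2)`!.
  move=> /setD1P[yc yA]; have yAc : y \in A :\ c by rewrite !inE yc.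
  have sc s : cyclic_on (A :\ c) s -> s c = c.
    by case/andP => sA _; rewrite (out_perm sA) // !inE eqxx.
  case: eqP => [fy|/eqP fy].
    rewrite big1 // => s /sc {}sc.
    by rewrite (arborescence_loop vW vw) // permM sc tpermL.
  pose f' z := if f z == v then f y else f z.
  have f'w : #|fiber (A :\ c) f' w| = #|fiber A f w| + (f y == w) * L.
    rewrite (card_fiberD1 f w cA) fc (negPf vw) add0n.
    case: (f y =P w) => [fyw|/eqP fyw].
      rewrite mul1n /L -cardsUI.
      rewrite [X in _ = _ + #|pred_of_set X|](_ : _ = set0) ?cards0 ?addn0.
        apply: eq_card => z; rewrite !inE /f' -andb_orr; congr andb.
        by have [_|_] := eqVneq (f z) v; rewrite ?fyw ?eqxx ?orbT ?orbF.
      apply/setP => z; rewrite !inE; apply/negbTE/negP.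
      by move=> /andP[/andP[_ /eqP ->]] /andP[_]; rewrite eq_sym (negPf vw).
    rewrite mul0n addn0; apply: eq_card => z; rewrite !inE /f'; congr andb.
    by have [->|_] := eqVneq (f z) v; rewrite // (negPf fyw) (negPf vw).
  rewrite (eq_bigr (fun s : {perm T} =>
    arborescence (W :\ v) w (fun v => f' (s (e v))) : nat)); last first.
    move=> s sA; have {}sc := sc s sA.
    rewrite (arborescence_contract vW vw) !permM ?sc ?tpermL ?fW //.
    congr nat_of_bool; apply: eq_arborescence => z /setD1P[zv zW] zw.
    have /setIdP[ezA /eqP fez] := eW z zW zw.
    have ezc : e z != c by apply: contraNneq zv => E; rewrite -fez E fc.
    have : s (e z) \in A :\ c by rewrite (cyclic_on_closed _ sA) !inE ezc.
    rewrite !permM /f' !inE => /andP[sc' _].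
    (* The transposition only affects a point that [s] sends to [y]: it now goes to [c], of colour
       [v], which the contraction replaces by [f y]. *)
    case: tpermP sc' => [->|-> _|/eqP yz /eqP yy _]; rewrite ?eqxx //.
    by rewrite fc eqxx (negPf fy).
  have Wv : #|W| = #|W :\ v|.+1 by rewrite (cardsD1 v W) vW.
  rewrite -f'w -[#|A|.-2]/(#|A|.-1.-1) {1 2}cD /= Wv subSS.
  apply: IH => //; first by rewrite -ltnS -Wv.
  - by apply/set0Pn; exists y.
  - by rewrite !inE eq_sym vw.
  - move=> z /setD1P[_ zA]; rewrite !inE /f'.
    by case: ifP => [_|->]; rewrite ?fy ?fW.
  - move=> z /setD1P[zv zW] zw; have /setIdP[ezA /eqP fez] := eW z zW zw.
    rewrite !inE /f' fez (negPf zv) eqxx ezA !andbT.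
    by apply: contraNneq zv => E; rewrite -fez E fc.
rewrite (sum_cyclic_onR _ cA A1) big_distrl /= (eq_bigr _ step).
rewrite (bigID (fun y => f y == v)) /= big1 => [|y /andP[_ ->] //].
rewrite add0n; under eq_bigr => y /andP[_ /negPf ->] do [].
rewrite -big_distrl /= big_split /= sum_nat_const -big_distrl /=.
have -> : \sum_(i in A :\ c | f i != v) (f i == w) = #|fiber A f w|.
  rewrite -big_mkcondr -sum1_card; apply: eq_bigl => z; rewrite !inE.
  have [->|_] := eqVneq z c; first by rewrite fc (negPf vw) !andbF.
  by case: (f z =P w) => [->|_]; rewrite ?andbF //= [w == v]eq_sym vw !andbT.
(* Summed over [y], the first terms give the root fibre once for each [y] not of colour [v], the
   second terms give it [L] times: [#|A|.-1] times in all. *)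
have LE : L + #|(fun i : T => (i \in A :\ c) && (f i != v))| = #|A|.-1.
  rewrite cD /= -(cardID [pred z | f z == v] (mem (A :\ c))); congr (_ + _).
    by apply: eq_card => z; rewrite !inE.
  by apply: eq_card => z; rewrite [LHS]unfold_in !inE andbC.
rewrite [X in X + _]mulnC -mulnDr addnC LE -mulnA.
by case: #|A| A1 => [|[|k]].
Qed.

End EulerianTours.

(** * The BEST theorem, for edges given by their end colours *)

Section BEST.
Local Open Scope nat_scope.
Variables T V : finType.
Implicit Types (A : {set T}) (f g : T -> V) (x y z : T) (u v w : V).

(* The candidates for the last edge out of [v] in a tour that starts with the
   edge [x]; the root and the absent colours get the dummy value [x]. *)
Definition exits A f x v : {set T} :=
  if (v != f x) && (v \in f @: A) then fiber A f v else [set x].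

Lemma fiberD1 A f v y : fiber (A :\ y) f v = fiber A f v :\ y.
Proof. by apply/setP => z; rewrite !inE andbA. Qed.

Lemma card_exits_family A f x :
  #|family (fun v => mem (exits A f x v))| = \prod_v #|exits A f x v|.
Proof. by rewrite card_family foldrE big_image. Qed.

Lemma exits_root A f x : exits A f x (f x) = [set x].
Proof. by rewrite /exits eqxx. Qed.

Lemma exits_fiber A f x v (e : {ffun V -> T}) :
  e \in family (fun v => mem (exits A f x v)) ->
  v \in f @: A -> v != f x -> e v \in fiber A f v.
Proof. by move=> /familyP/(_ v) + vA vx; rewrite /exits vx vA. Qed.

(** With [z] read as an edge from [f z] to [g z], the successor of each edge starts where that edge
    ends. *)
Definition matching A f g (s : {perm T}) := [forall z in A, f (s z) == g z].

(** If [y] follows [x], the path through both becomes one edge from [f x] to [g y], which keeps the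
    name [x]. *)
Lemma matching_tperm A f g x y (s : {perm T}) :
    x \in A -> y \in A -> y != x -> s y = y ->
  matching A f g (tperm x y * s)%g =
  (f y == g x) && matching (A :\ y) f (fun z => if z == x then g y else g z) s.
Proof.
move=> xA yA yx sy; apply/forall_inP/andP => [m|[fy /forall_inP m] z zA].
  split; first by have := m x xA; rewrite permM tpermL sy.
  apply/forall_inP => z /setD1P[zy zA]; have [->|zx] := eqVneq z x.
    by have := m y yA; rewrite permM tpermR.
  by have := m z zA; rewrite permM tpermD // eq_sym.
rewrite permM; case: tpermP => [->|->|/eqP zx /eqP zy]; first by rewrite sy.
  by have := m x; rewrite eqxx !inE eq_sym yx xA; apply.
by have := m z; rewrite (negPf zx) !inE zy zA; apply.
Qed.

Lemma fiber_contract A f g x y v : x \in A -> y \in A -> y != x -> f y = g x ->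
  #|fiber A f v| = #|fiber A g v| ->
  #|fiber (A :\ y) f v| =
  #|fiber (A :\ y) (fun z => if z == x then g y else g z) v|.
Proof.
move=> xA yA yx fy; have xAy : x \in A :\ y by rewrite !inE eq_sym yx.
rewrite (card_fiberD1 f v yA) (card_fiberD1 g v yA) (card_fiberD1 g v xAy).
rewrite (card_fiberD1 (fun z => if z == x then g y else g z) v xAy) eqxx fy.
rewrite (@eq_fiber _ _ _ (fun z => if z == x then g y else g z) g) => [|z]; first lia.
by rewrite !inE => /andP[/negPf->].
Qed.

(* The number of Eulerian tours of the directed graph on [V] with an edge
   [f z -> g z] for each [z] in [A] (the BEST theorem).  The induction merges
   [x] with the edge [y] that follows it in the tour; the root [f x] stays. *)
Lemma card_cyclic_matching A f g x : x \in A ->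
    (forall v, #|fiber A f v| = #|fiber A g v|) ->
  \sum_(s | cyclic_on A s) matching A f g s =
  \prod_v (#|fiber A f v|.-1)`! *
  \sum_(e in family (fun v => mem (exits A f x v)))
     arborescence (f @: A) (f x) (fun v => g (e v)).
Proof.
have [n] := ubnP #|A|; elim: n A g => // n IH A g An xA bal.
have [A1|A1] := leqP #|A| 1.
  move: bal; have -> : A = [set x].
    by apply/eqP; rewrite eq_sym eqEcard sub1set xA cards1.
  move=> bal; rewrite [X in X * _]big1 => [|v _]; last first.
    have : #|fiber [set x] f v| <= 1.
      rewrite -(cards1 x); apply/subset_leq_card/subsetP => z.
      by case/setIdP.
    by case: #|_| => [|[]].
  rewrite imset_set1 mul1n (eq_bigl _ _ (cyclic_on_set1 x)) big_pred1_eq.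
  rewrite (eq_bigr (fun=> 1)) => [|e _]; last by rewrite arborescence_set1.
  rewrite sum1_card card_exits_family big1 => [|v _]; last first.
    rewrite /exits imset_set1 inE; case: eqP => _; exact: cards1.
  rewrite (_ : matching _ _ _ _) //; apply/forall_inP => z /set1P->.
  rewrite perm1 eq_sym; have F0 (h : T -> V) v : #|fiber set0 h v| = 0.
    by apply/eqP; rewrite cards_eq0; apply/eqP/setP => t; rewrite !inE.
  have := bal (f x); rewrite !(card_fiberD1 _ _ (set11 x)) setDv !F0 eqxx.
  by case: (g x == f x).
rewrite (sum_cyclic_onL _ xA A1).
pose u := g x.
have step y : y \in A :\ x ->
  \sum_(s | cyclic_on (A :\ y) s) matching A f g (tperm x y * s)%g =
  (f y == u) * (\prod_v (#|fiber (A :\ y) f v|.-1)`! *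
     \sum_(e in family (fun v => mem (exits (A :\ y) f x v)))
        arborescence (f @: (A :\ y)) (f x) (fun v => g (e v))).
  move=> /setD1P[yx yA].
  have E s : cyclic_on (A :\ y) s -> matching A f g (tperm x y * s)%g =
    (f y == g x) && matching (A :\ y) f (fun z => if z == x then g y else g z) s.
    case/andP => sA _; apply: matching_tperm => //.
    by rewrite (out_perm sA) // !inE eqxx.
  rewrite (eq_bigr _ (fun s sA => congr1 nat_of_bool (E s sA))) -/u.
  have [fy|_] := eqVneq (f y) u; last by rewrite big1.
  rewrite mul1n IH; first last.
  - by move=> v; apply: fiber_contract.
  - by rewrite !inE eq_sym yx.
  - by have := cardsD1 y A; rewrite yA /=; lia.
  (* The merged edge [x] starts at the root, so it is no exit from another colour and the original
     [g] can be kept. *)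
  congr (_ * _); apply: eq_bigr => e eF; congr nat_of_bool.
  apply: eq_arborescence => v vA vx.
  have /setIdP[_ /eqP fe] := exits_fiber eF vA vx.
  by case: eqP => // ex; rewrite -fe ex eqxx in vx.
rewrite (eq_bigr _ step).
pose L := #|fiber A f u|.
have L0 : 0 < L by rewrite /L bal card_gt0; apply/set0Pn; exists x; rewrite inE xA /=.
(* If at least two edges leave [u], deleting one of them keeps every colour present; if only one
   does, [u] may disappear. *)
have [L1|L2] := leqP L 1; last first.
  have prodE y : f y = u -> y \in A ->
      \prod_v (#|fiber A f v|.-1)`! = L.-1 * \prod_v (#|fiber (A :\ y) f v|.-1)`!.
    move=> fy yA; rewrite (bigD1 u) //= [in RHS](bigD1 u) //= mulnA; congr (_ * _).
      have := card_fiberD1 f u yA; rewrite -/L fy eqxx => LE.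
      by rewrite LE /=; case: #|_| LE L2 => [|k] ->.
    apply: eq_bigr => v vu; rewrite (card_fiberD1 f v yA) fy.
    by rewrite eq_sym (negPf vu).
  have imE y : f y = u -> y \in A -> f @: (A :\ y) = f @: A.
    move=> fy yA; apply/setP => v; rewrite !fiber_imset -!card_gt0.
    rewrite (card_fiberD1 f v yA) fy; case: (u =P v) => [<-|] //=.
    by have := card_fiberD1 f u yA; rewrite -/L fy eqxx; lia.
  have famE y : f y = u -> y \in A -> y != x -> 
      family (fun v => mem (exits (A :\ y) f x v)) =i
      [pred e | (e \in family (fun v => mem (exits A f x v))) && (e u != y)].
    move=> fy yA yx e; rewrite [in RHS]inE /=.
    apply/familyP/andP => [eF|[/familyP eF eu] v].
      split.
        apply/familyP => v; move: (eF v); rewrite /exits imE // fiberD1.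
        by case: ifP => // _ /setD1P[].
      have := eF u; rewrite /exits imE // fiberD1.
      by case: ifP => _; [move/setD1P => []|move/set1P->; rewrite eq_sym].
    have := eF v; rewrite /exits imE // fiberD1; case: ifP => // _ ev.
    rewrite inE ev andbT inE; move: ev; rewrite inE => /andP[_ /eqP fev].
    by apply: contraNneq eu => evy; rewrite -fy -evy fev.
  have Lm : 0 < L.-1 by lia.
  apply/eqP; rewrite -(eqn_pmul2l Lm); apply/eqP.
  rewrite big_distrr /=.
  (* Deleting [y] forbids exactly the choices with [e u = y]. A fixed [e] therefore survives for
     [L.-1] of the edges [y]: those leaving [u] other than [e u], where [e u = x] if [u] is the
     root. *)
  pose S y := \sum_(e in family (fun v => mem (exits A f x v)))
    ((f y == u) && (e u != y)) * arborescence (f @: A) (f x) (fun v => g (e v)).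
  rewrite (eq_bigr (fun y => (\prod_v (#|fiber A f v|.-1)`!) * S y)).
    rewrite -big_distrr /= mulnCA; congr (_ * _).
    rewrite exchange_big big_distrr /=; apply: eq_bigr => e eF.
    rewrite -big_distrl /=; congr (_ * _).
    have eu : e u \in fiber A f u.
      have [ux|ux] := eqVneq u (f x).
        have /familyP/(_ u) := eF; rewrite {2}ux exits_root => /set1P ->.
        by rewrite inE xA ux /=.
      by apply: (exits_fiber eF); rewrite // fiber_imset -card_gt0.
    rewrite /L (cardsD1 (e u)) eu /= -sum1_card big_mkcond [RHS]big_mkcond /=.
    apply: eq_bigr => y _; rewrite !inE [y == e u]eq_sym.
    have [eu_y|eu_y] := eqVneq (e u) y; first by rewrite andbF if_same.
    rewrite andbT /= andbC; case: (f y =P u) => [fy|_]; rewrite ?andbF ?if_same //.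
    have [yx|//] := eqVneq y x; case/eqP: eu_y.
    by rewrite -fy yx; have /familyP/(_ (f x)) := eF; rewrite exits_root => /set1P.
  move=> y /setD1P[yx yA]; rewrite /S; case: (f y =P u) => [fy|_]; last first.
    by rewrite /= mul0n muln0 [X in _ = _ * X]big1 ?muln0 // => e _; rewrite mul0n.
  rewrite mul1n mulnA -prodE // imE //; congr (_ * _).
  rewrite (eq_bigl _ _ (famE y fy yA yx)) big_mkcondr /=.
  by apply: eq_bigr => e _; case: (e u != y); rewrite ?mul1n.
have {L0}L1 : L = 1 by lia.
(* By balance only one edge enters [u], and it is [x]. *)
have gN z : z \in A -> z != x -> g z != u.
  move=> zA zx; have := bal u; rewrite -/L L1 (card_fiberD1 g u xA) eqxx.
  have zAx : z \in A :\ x by rewrite !inE zx.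
  by rewrite (card_fiberD1 g u zAx); case: eqP.
have eN (e : {ffun V -> T}) v :
    e \in family (fun v => mem (exits A f x v)) -> v \in f @: A -> v != f x ->
    [/\ e v \in A, f (e v) = v & g (e v) != u].
  move=> eF vA vx; have /setIdP[evA /eqP fev] := exits_fiber eF vA vx.
  split=> //; apply: gN => //; by apply: contraNneq vx => ex; rewrite -fev ex.
(* If [u] is the root, [x] is a loop isolated from the other edges, so there is neither a tour nor
   an arborescence. *)
have [ux|ux] := eqVneq u (f x).
  have fN z : z \in A -> z != x -> f z != u.
    move=> zA zx; move: L1; rewrite /L (card_fiberD1 f u xA) ux eqxx.
    have zAx : z \in A :\ x by rewrite !inE zx.
    by rewrite (card_fiberD1 f (f x) zAx); case: eqP.
  rewrite big1 => [|y /setD1P[yx yA]]; last by rewrite (negPf (fN y yA yx)) mul0n.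
  rewrite [X in _ = _ * X]big1 ?muln0 // => e eF.
  have /card_gt0P[z /setD1P[zx zA]] : 0 < #|A :\ x|.
    by move: A1; rewrite (cardsD1 x A) xA.
  case: arborescenceP => // /(_ [set f x]); rewrite set11 => /(_ isT) a.
  have /subsetP/(_ (f z)) : f @: A \subset [set f x].
    apply: a => v vA; rewrite !inE -ux => /eqP gev; have [//|vx] := eqVneq v u.
    by rewrite ux in vx; have [_ _ /eqP] := eN e v eF vA vx.
  by rewrite imset_f // inE -ux (negPf (fN z zA zx)) => /(_ isT).
(* Otherwise the only edge [y] out of [u] must follow [x], and merging them removes the colour
   [u]. *)
have /eqP/cards1P[y fibE] := L1.
have /setIdP[yA /eqP fy] : y \in fiber A f u by rewrite fibE set11.
have yx : y != x by apply: contraNneq ux => <-; rewrite fy.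
rewrite (bigD1 y) /=; last by rewrite !inE yx.
rewrite [X in _ + X]big1 ?addn0 => [|z /andP[/setD1P[zx zA] zy]]; last first.
  case: eqP => // fz; have : z \in fiber A f u by rewrite inE zA fz /=.
  by rewrite fibE inE (negPf zy).
rewrite fy eqxx mul1n.
have fibD v : v != u -> fiber (A :\ y) f v = fiber A f v.
  move=> vu; apply/setP => z; rewrite !inE; have [->|//] := eqVneq z y.
  by rewrite fy [u == v]eq_sym (negPf vu) !andbF.
have fibu : fiber (A :\ y) f u = set0 by rewrite fiberD1 fibE setDv.
congr (_ * _).
  apply: eq_bigr => v _; have [->|/fibD->//] := eqVneq v u.
  by rewrite fibu fibE cards0 cards1.
have uA : u \in f @: A by rewrite -fy imset_f.
have imD : f @: (A :\ y) = f @: A :\ u.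
  apply/setP => v; rewrite in_setD1 !fiber_imset.
  by have [->|/fibD->] := eqVneq v u; rewrite // fibu eqxx.
have exD v : v != u -> exits (A :\ y) f x v = exits A f x v.
  by move=> vu; rewrite /exits imD in_setD1 vu fibD.
have exu : exits A f x u = [set y] by rewrite /exits ux uA fibE.
have exDu : exits (A :\ y) f x u = [set x].
  by rewrite /exits imD in_setD1 eqxx andbF.
(* The two families differ only at [u], where the forced exit [y] becomes the dummy value [x]. *)
pose upd (t : T) (e : {ffun V -> T}) := [ffun v => if v == u then t else e v].
rewrite (reindex_onto (upd x) (upd y)) /=; last first.
  move=> e /familyP/(_ u); rewrite exDu => /set1P eu.
  by apply/ffunP => v; rewrite !ffunE; case: eqP => // ->.
apply: eq_big => e.
  apply/andP/familyP => [[/familyP eF /eqP E] v|eF].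
    have := eF v; rewrite ffunE; have [->|vu] := eqVneq v u.
      by move=> _; rewrite -E ffunE eqxx exu set11.
    by rewrite exD.
  split.
    apply/familyP => v; rewrite ffunE; have [->|vu] := eqVneq v u.
      by rewrite exDu set11.
    by rewrite exD.
  apply/eqP/ffunP => v; rewrite !ffunE; case: eqP => // ->.
  by have := eF u; rewrite exu => /set1P.
move=> /andP[/familyP uF /eqP E].
have eF : e \in family (fun v => mem (exits A f x v)).
  apply/familyP => v; have := uF v; rewrite ffunE; have [->|vu] := eqVneq v u.
    by move=> _; rewrite -E ffunE eqxx exu set11.
  by rewrite exD.
have eu : e u = y by rewrite -E ffunE eqxx.
(* Contracting the edge out of [u] redirects nothing, since no chosen exit enters [u]. *)
congr nat_of_bool; rewrite [RHS](arborescence_contract uA) //; first last.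
- rewrite eu fiber_imset -card_gt0 bal card_gt0; apply/set0Pn; exists y.
  by rewrite inE yA /=.
- by rewrite eu gN.
rewrite imD; apply: eq_arborescence => v /setD1P[vu vA] vx.
have [_ _ gev] := eN e v eF vA vx.
by rewrite ffunE (negPf vu) (negPf gev).
Qed.


End BEST.

(** * Pairs of cycles compatible with a colouring *)

Section PairsOfCycles.
Local Open Scope nat_scope.
Variables T V : finType.
Implicit Types (A B : {set T}) (x y z : T) (v w : V).

Lemma card_supersets B k : k <= #|T| ->
  #|[set A : {set T} | B \subset A & #|A| == k]| = 'C(#|T| - #|B|, #|T| - k).
Proof.
move=> kT; have -> : #|T| - #|B| = #|~: B| by rewrite [RHS]cardsCs setCK.
rewrite -cards_draws.
rewrite -(card_imset _ (@setC_inj T)); apply: eq_card => A.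
apply/imsetP/idP => [[C]|].
  rewrite !inE => /andP[BC /eqP Ck] ->.
  by rewrite setCS BC -Ck [X in X == _]cardsCs setCK /=.
rewrite inE => /andP[AB /eqP Ak]; exists (~: A); last by rewrite setCK.
by rewrite inE -setCS setCK AB /= [X in X == _]cardsCs setCK Ak subKn.
Qed.

Lemma card_fiber_perm (f : T -> V) (s : {perm T}) v :
  #|fiber setT (fun z => f (s z)) v| = #|fiber setT f v|.
Proof.
rewrite -(card_imset _ (@perm_inj _ s)); apply: eq_card => z.
rewrite !inE; apply/imsetP/idP => [[t]|fz]; first by rewrite !inE => ft ->.
by exists (s^-1 z)%g; rewrite ?inE permKV.
Qed.

(** If [A] misses some [e v], that point is fixed and gives a loop at [v]. So [A] contains [D], and
    counting it with a marked point of the root colour amounts to counting supersets of a set of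
    [#|f @: setT|] points. *)
Lemma sum_cyclic_arborescence (f : T -> V) w (e : V -> T) k :
    w \in f @: setT -> {in f @: setT, forall v, v != w -> f (e v) = v} ->
    0 < k <= #|T| ->
  (\sum_(A : {set T} | #|A| == k) \sum_(s | cyclic_on A s)
      arborescence (f @: setT) w (fun v => f (s (e v)))) * (k - #|f @: setT|).+1 =
  #|fiber setT f w| * (k.-1)`! * 'C(#|T| - #|f @: setT|, #|T| - k).
Proof.
set W := f @: setT => wW fe /andP[k0 kT]; pose D := e @: (W :\ w).
have cardD : #|D| = #|W|.-1.
  rewrite card_in_imset => [|u v /setD1P[uw uW] /setD1P[vw vW] E].
    by rewrite (cardsD1 w W) wW.
  by rewrite -(fe u) // E fe.
have W0 : 0 < #|W| by apply/card_gt0P; exists w.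
have step A : #|A| == k ->
  (\sum_(s | cyclic_on A s) arborescence W w (fun v => f (s (e v)))) *
    (k - #|W|).+1 =
  (\sum_(z in fiber setT f w) ((D \subset A) && (z \in A))) * (k.-1)`!.
  move=> /eqP Ak; have [/subsetP DA|/subsetPn[z /imsetP[v /setD1P[vw vW] ->] eA]]
    := boolP (D \subset A).
    rewrite -Ak card_cyclic_arborescence //; first last.
    - by move=> v vW vw; rewrite inE fe // eqxx andbT DA // imset_f // !inE vw.
    - by move=> z _; rewrite imset_f.
    - by rewrite -card_gt0 Ak.
    congr (_ * _); rewrite -sum1_card big_mkcond [RHS]big_mkcond /=.
    by apply: eq_bigr => z _; rewrite !inE; case: (f z == w); case: (z \in A).
  rewrite big1 => [|s /andP[sA _]]; first by rewrite big1.
  by rewrite (arborescence_loop vW vw) // (out_perm sA) // fe.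
rewrite big_distrl /= (eq_bigr _ step) -big_distrl /= mulnAC; congr (_ * _).
rewrite exchange_big /= -sum_nat_const; apply: eq_bigr => z.
rewrite inE => /andP[_ /eqP fz].
have zD : z \notin D.
  apply/imsetP => -[v /setD1P[vw vW] E].
  by have := fe v vW vw; rewrite -E fz => wv; rewrite wv eqxx in vw.
rewrite -(prednK W0) -cardD -add1n -(_ : #|z |: D| = 1 + #|D|); last first.
  by rewrite cardsU1 zD.
rewrite -card_supersets // -sum1_card big_mkcond [RHS]big_mkcond /=.
apply: eq_bigr => A _; rewrite !inE subUset sub1set.
by rewrite [(z \in A) && _]andbC; case: (_ == k); rewrite ?andbF //; case: andP.
Qed.

(** The exits of each non-root colour present, and the root fibre, supply the factor that completes
    each factorial; an absent colour has one dummy exit. *)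
Lemma prod_exits (f : T -> V) x :
  \prod_v (#|fiber setT f v|.-1)`! *
  (#|family (fun v => mem (exits setT f x v))| * #|fiber setT f (f x)|) =
  \prod_v #|fiber setT f v|`!.
Proof.
rewrite card_exits_family mulnA -big_split /= (bigD1 (f x)) //=.
rewrite [RHS](bigD1 (f x)) //= mulnAC; congr (_ * _).
  rewrite exits_root cards1 muln1 mulnC.
  have : 0 < #|fiber setT f (f x)|.
    by apply/card_gt0P; exists x; rewrite !inE eqxx.
  by case: #|_|.
apply: eq_bigr => v vx; rewrite /exits vx fiber_imset -card_gt0 /=.
have [F0|F0] := posnP #|fiber setT f v|; first by rewrite F0 /= cards1.
by rewrite -[in RHS](prednK F0) factS prednK // mulnC.
Qed.

(** An arbitrary [x] starts the tours. Apart from the factorials, which complete the product by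
    [prod_exits], the result depends on [f] only through its number of colours. *)
Lemma card_cyclic_pairs (f : T -> V) k : 0 < k <= #|T| ->
  (\sum_(A : {set T} | #|A| == k) \sum_(b | cyclic_on A b)
     \sum_(a | cyclic_on setT a) matching setT f (fun z => f (b z)) a) *
    (k - #|f @: setT|).+1 =
  \prod_v #|fiber setT f v|`! * ((k.-1)`! * 'C(#|T| - #|f @: setT|, #|T| - k)).
Proof.
move=> kT; have /card_gt0P[x _] : 0 < #|T| by lia.
pose fam := family (fun v => mem (exits setT f x v)).
pose F (e : {ffun V -> T}) :=
  \sum_(A : {set T} | #|A| == k) \sum_(b | cyclic_on A b)
      (arborescence (f @: setT) (f x) (fun v => f (b (e v))) : nat).
rewrite (_ : \sum_(A | _) _ =
  \prod_v (#|fiber setT f v|.-1)`! * \sum_(e in fam) F e); last first.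
  rewrite /F [in RHS]exchange_big /= big_distrr; apply: eq_bigr => A _ /=.
  rewrite [in RHS]exchange_big /= big_distrr; apply: eq_bigr => b _ /=.
  apply: card_cyclic_matching => [|v]; first by rewrite inE.
  by rewrite card_fiber_perm.
rewrite -(prod_exits f x) -/fam -[LHS]mulnA -[RHS]mulnA; congr (_ * _).
rewrite big_distrl -[RHS]mulnA /= -[RHS](sum_nat_const fam); apply: eq_bigr => e eF.
rewrite mulnA; apply: sum_cyclic_arborescence => //; first exact: imset_f.
by move=> v vW vw; have /setIdP[_ /eqP] := exits_fiber eF vW vw.
Qed.

End PairsOfCycles.

(** * Cycle types and power sums *)

Lemma sorted_geq_perm_eq (s t : seq nat) : sorted geq s -> sorted geq t ->
  perm_eq s t -> s = t.
Proof.
have geq_tr : transitive geq by move=> y x z /= yx zy; apply: leq_trans zy yx.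
have geq_as : antisymmetric geq.
  by move=> x y /= xy; apply/eqP; rewrite eqn_leq andbC.
exact: (sorted_eq geq_tr geq_as).
Qed.

Section HookCycleType.
Local Open Scope nat_scope.
Variable n : nat.
Implicit Types (s : 'S_n) (A B : {set 'I_n}).

Lemma perm_eq_cycle_type s :
  perm_eq (cycle_type s) [seq #|X| | X : {set 'I_n} in porbits s].
Proof. by apply/permPl/perm_sort. Qed.

Lemma cycle_type_eqE s (l : seq nat) : sorted geq l ->
  (cycle_type s == l) = perm_eq [seq #|X| | X : {set 'I_n} in porbits s] l.
Proof.
move=> sl; rewrite -(permPl (perm_eq_cycle_type s)); apply/eqP/idP => [->//|].
apply: sorted_geq_perm_eq => //.
by apply: sort_sorted => x y; exact: leq_total.
Qed.

Lemma cyclic_on_porbits A B s : cyclic_on A s -> B \in porbits s -> B != A ->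
  #|B| = 1.
Proof.
move=> /andP[sA /imsetP[y _ AE]] /imsetP[x _ ->] BA.
have xA : x \notin A by apply: contra BA => xA; rewrite AE eq_porbit_mem -AE.
by rewrite porbit_fixed ?cards1 // (out_perm sA).
Qed.

Lemma cyclic_on_hook_type A s : cyclic_on A s ->
  cycle_type s = hook_type n (n - #|A|).
Proof.
move=> cA; have := cA; rewrite cyclic_onE card_ord => /and3P[A0 _ /eqP cE].
have An : #|A| <= n by rewrite -[n in _ <= n]card_ord max_card.
have A1 : 0 < #|A| by rewrite card_gt0.
have [_ AP] := andP cA.
apply/eqP; rewrite cycle_type_eqE; last first.
  have /hook_type_partn/and3P[] : n - #|A| < n by lia.
  by [].
have AE : A \in enum (porbits s) by rewrite mem_enum.
rewrite (perm_trans (perm_map _ (perm_to_rem AE))) //= /hook_type subKn //.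
have /all_pred1P -> :
    all (pred1 1) [seq #|X| | X : {set 'I_n} <- rem A (enum (porbits s))].
  apply/allP => _ /mapP[B + ->]; rewrite mem_rem_uniq ?enum_uniq // inE mem_enum.
  by move=> /andP[BA BP] /=; rewrite (cyclic_on_porbits cA BP BA).
by rewrite size_map size_rem // -cardE (_ : _.-1 = n - #|A|) ?perm_refl //; lia.
Qed.

Lemma hook_type_cyclic_on a s : a < n -> cycle_type s = hook_type n a ->
  exists2 A : {set 'I_n}, #|A| = n - a & cyclic_on A s.
Proof.
move=> an /eqP; rewrite cycle_type_eqE; last first.
  by have /and3P[] := hook_type_partn an.
move=> pe; have : n - a \in [seq #|X| | X : {set 'I_n} in porbits s].
  by rewrite (perm_mem pe) inE eqxx.
case/mapP => A; rewrite mem_enum => AP AE; exists A => //.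
have AE' : A \in enum (porbits s) by rewrite mem_enum.
move: pe; rewrite (permPl (perm_map _ (perm_to_rem AE'))) /= -AE perm_cons => pe.
have one B : B \in porbits s -> B != A -> #|B| = 1.
  move=> BP BA; have : #|B| \in nseq a 1.
    rewrite -(perm_mem pe); apply: map_f.
    by rewrite mem_rem_uniq ?enum_uniq // inE mem_enum /= BA.
  by move/nseqP => [].
rewrite /cyclic_on AP andbT; apply/subsetP => z; rewrite inE; apply: contraR => zA.
have /one : porbit s z \in porbits s by apply: imset_f.
have zP := porbit_id s z; move=> /(_ _)/eqP/cards1P[|t E].
  by apply: contraNneq zA => <-.
move: zP (mem_porbit s 1 z); rewrite E expg1 !inE => /eqP -> /eqP ->.
by [].
Qed.

(** The long cycle determines [A]. The second hypothesis ensures uniqueness: for [n - a = 1 < n] the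
    identity is cyclic on every singleton. *)
Lemma sum_hook_type a (F : 'S_n -> nat) : a < n -> (n - a = 1 -> n = 1) ->
  \sum_(s | cycle_type s == hook_type n a) F s =
  \sum_(A : {set 'I_n} | #|A| == n - a) \sum_(s | cyclic_on A s) F s.
Proof.
move=> an hn; rewrite (exchange_big_dep xpredT) //= big_mkcond /=.
apply: eq_bigr => s _; case: eqP => [/(hook_type_cyclic_on an)[A Ak sA]|sN].
  rewrite (big_pred1 A) // => B; apply/andP/eqP => [[/eqP Bk sB]|->]; last first.
    by rewrite Ak.
  apply/eqP; have [//|BA] := eqVneq B A.
  have [_ BP] := andP sB; have := cyclic_on_porbits sA BP BA; rewrite Bk => /hn n1.
  have full (C : {set 'I_n}) : #|C| = n - a -> C = setT.
    by move=> Ck; apply/eqP; rewrite eqEcard subsetT cardsT card_ord Ck; lia.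
  by case/eqP: BA; rewrite (full A) // (full B).
rewrite big_pred0 // => A; apply/andP => -[/eqP Ak /cyclic_on_hook_type].
by rewrite Ak subKn // ltnW.
Qed.

End HookCycleType.

(** * Power sums as sums over colourings *)

Section PowerSums.
Variables (C : comNzRingType) (n N : nat).
Implicit Types (s : 'S_n) (f : {ffun 'I_n -> 'I_N}) (m : 'X_{1..N}).

Definition word_poly f : {mpoly C[N]} := \prod_i 'X_(f i).

Definition content f : 'X_{1..N} := [multinom #|fiber setT f v| | v < N].

Lemma mcoeff_word_poly f m : (word_poly f)@_m = (content f == m)%:R.
Proof.
rewrite /word_poly -(big_morph _ (@mpolyXD N C) (mpolyX0 _ _)) mcoeffX.
congr (_ == m)%:R.
apply/mnmP => v; rewrite mnm_sumE mnmE -sum1_card [RHS]big_mkcond /=.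
by apply: eq_bigr => i _; rewrite mnmE !inE; case: eqP.
Qed.

Lemma sumX_exp_words :
  (\sum_(j < N) 'X_j) ^+ n = \sum_(f : {ffun 'I_n -> 'I_N}) word_poly f.
Proof.
rewrite -(bigA_distr_bigA (fun (_ : 'I_n) j => 'X_j : {mpoly C[N]})).
by rewrite prodr_const card_ord.
Qed.

Lemma porbit_const s (f : 'I_n -> 'I_N) i j :
  (forall i, f (s i) = f i) -> j \in porbit s i -> f j = f i.
Proof.
move=> fs /porbitP[k ->].
by elim: k => [|k IH]; rewrite ?perm1 // expgSr permM fs.
Qed.

(** Expanding the product chooses one variable for each cycle, which is a colouring constant on
    cycles. *)
Lemma powersum_cycle_type s : powersum C (cycle_type s) N =
  \sum_(f : {ffun 'I_n -> 'I_N} | [forall i, f (s i) == f i]) word_poly f.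
Proof.
rewrite -[LHS]/(sf_eval N _) rmorph_prod /= (perm_big _ (perm_eq_cycle_type s)) /=.
rewrite big_map big_enum /= big_sub.
(* Orbits are nonempty, so the junk value of [psum] at 0 is never met. *)
have psumE (X : {X | X \in porbits s}) :
    sf_eval N (psum C #|\val X|) = \sum_(j < N) 'X_j ^+ #|\val X|.
  rewrite -[LHS]/(psum_poly C #|\val X| N); case: X => X /= /imsetP[x _ ->].
  by case: #|_| (card_porbit_neq0 s x).
rewrite (eq_bigr _ (fun X _ => psumE X)) bigA_distr_bigA /=.
have orbP i : porbit s i \in porbits s by apply: imset_f.
pose orb i : {X | X \in porbits s} := exist _ (porbit s i) (orbP i).
have repP (X : {X | X \in porbits s}) : exists i, orb i == X.
  by have /imsetP[i _ E] := valP X; exists i; rewrite -val_eqE /= E.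
pose rep X := xchoose (repP X).
have repK X : orb (rep X) = X by apply/eqP/(xchooseP (repP X)).
pose ext (c : {ffun {X | X \in porbits s} -> 'I_N}) : {ffun 'I_n -> 'I_N} :=
  [ffun i => c (orb i)].
pose res (f : {ffun 'I_n -> 'I_N}) := [ffun X => f (rep X)].
rewrite [RHS](reindex_onto ext res) /=; last first.
  move=> f /forallP inv; apply/ffunP => i; rewrite !ffunE.
  apply: (porbit_const (s := s)) => [j|]; first exact/eqP.
  by have := congr1 val (repK (orb i)); rewrite /= => <-; rewrite porbit_id.
apply: eq_big => [c|c _].
  apply/esym/andP; split; last by apply/eqP/ffunP => X; rewrite !ffunE repK.
  apply/forallP => i; rewrite !ffunE; apply/eqP; congr (c _); apply: val_inj.
  by have := porbit_perm s 1 i; rewrite expg1.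
rewrite /word_poly (partition_big orb xpredT) //=; apply: eq_bigr => X _.
rewrite (eq_bigr (fun=> 'X_(c X))) => [|i /eqP Xi]; last by rewrite ffunE Xi.
rewrite prodr_const; congr (_ ^+ _); apply: eq_card => i.
rewrite -[RHS]/(orb i == X) -val_eqE /=.
have /imsetP[x _ ->] := valP X.
by rewrite eq_porbit_mem.
Qed.

End PowerSums.

(** * Multinomial coefficients *)

Section Multinomial.
Variables (C : comNzRingType) (N : nat).

Lemma mcoeffMXU (p : {mpoly C[N]}) j (m : 'X_{1..N}) :
  (p * 'X_j)@_m = if m j == 0%N then 0 else p@_(m - U_(j))%MM.
Proof.
case: eqP => [mj|/eqP mj]; last first.
  have Um : (U_(j) <= m)%MM by rewrite lep1mP.
  by rewrite -[in LHS](submK Um) addmC mcoeffMX.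
rewrite (mpolyE p) mulr_suml raddf_sum big1 // => k _ /=.
rewrite -scalerAl mcoeffZ -mpolyXD mcoeffX.
case: eqP => [E|_]; last by rewrite mulr0.
by move: mj; rewrite -E mnmDE mnmE eqxx addn1.
Qed.

Lemma mcoeff_sumX_exp n (m : 'X_{1..N}) : mdeg m = n ->
  ((\sum_(j < N) 'X_j) ^+ n)@_m * (\prod_v (m v)`!)%:R = n`!%:R :> C.
Proof.
elim: n m => [|n IH] m dm.
  have /eqP -> : m == 0%MM by rewrite -mdeg_eq0 dm.
  rewrite expr0 mcoeff1 eqxx mul1r big1 // => v _.
  by rewrite mnmE.
rewrite exprSr mulr_sumr raddf_sum /= mulr_suml.
rewrite factS -dm mdegE natrM natr_sum mulr_suml.
apply: eq_bigr => j _; rewrite mcoeffMXU.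
case: eqP => [->|/eqP mj]; first by rewrite !mul0r.
have Um : (U_(j) <= m)%MM by rewrite lep1mP.
rewrite -(IH (m - U_(j))%MM); last first.
  by move: dm; rewrite -[in mdeg m](submK Um) mdegD mdeg1 addn1 => -[].
rewrite mulrCA; congr (_ * _); rewrite -natrM; congr (_%:R).
rewrite (bigD1 j) //= [in RHS](bigD1 j) //= mulnA; congr (_ * _)%N.
  rewrite mnmBE mnmE eqxx subn1.
  by case: (m j) mj.
by apply: eq_bigr => v vj; rewrite mnmBE mnmE eq_sym (negPf vj) subn0.
Qed.
End Multinomial.

(** * Monomial coefficients *)

Lemma psi_class_sum_mul (C : fieldType) n (l l' : seq nat) :
  psi (class_sum C n l * class_sum C n l') =
  n`!%:R^-1 *: \sum_(s | cycle_type s == l) \sum_(t | cycle_type t == l')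
    powersum C (cycle_type (s * t : 'S_n)%g).
Proof.
rewrite /class_sum mulr_suml linear_sum scaler_sumr; apply: eq_bigr => s _.
rewrite mulr_sumr linear_sum scaler_sumr; apply: eq_bigr => t _ /=.
by rewrite geltM psi_gelt.
Qed.

Section NonzeroExponents.
Variable N : nat.
Implicit Type m : 'X_{1..N}.

Definition exponents m : seq nat := [seq k <- m | k != 0%N].

Lemma size_exponents m : size (exponents m) = #|[set v | m v != 0%N]|.
Proof.
rewrite size_filter -sum1_count -sum1_card big_tuple.
by apply: eq_bigl => v; rewrite inE.
Qed.

Lemma sumn_exponents m : sumn (exponents m) = mdeg m.
Proof.
rewrite /exponents /mdeg sumnE big_filter [LHS]big_mkcond /=.
by apply: eq_bigr => k _; case: eqP.
Qed.

Lemma exponents_is_intpartn m : is_intpartn (mdeg m) (sort geq (exponents m)).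
Proof.
apply/and3P; split; first by apply: sort_sorted => x y; exact: leq_total.
  by rewrite mem_sort mem_filter eqxx.
by rewrite -sumn_exponents (perm_sumn (permEl (perm_sort _ _))).
Qed.

End NonzeroExponents.

Lemma parts_inj n : injective (@parts n).
Proof.
by move=> l l' /(inj_map val_inj) /val_inj/val_inj.
Qed.

(** At most one partition contributes: the sorted list of nonzero exponents of [m]. *)
Lemma mcoeff_monomial_sum (C : comNzRingType) n (P : pred nat) (c : nat -> C) N
    (m : 'X_{1..N}) :
  ((\sum_(l : intpartn n | P (size l)) c (size l) *: monomial C l) N)@_m =
  if (mdeg m == n) && P (size (exponents m)) then c (size (exponents m)) else 0.
Proof.
set S := (\sum_(l | _) _ : symfun C); rewrite -[sf_poly S N]/(sf_eval N S).
rewrite linear_sum raddf_sum /=.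
have E (l : intpartn n) : (sf_eval N (c (size l) *: monomial C l))@_m =
    if perm_eq (exponents m) l then c (size l) else 0.
  rewrite -[sf_eval N _]/(c (size l) *: monomial_poly C l N).
  rewrite mcoeffZ mcoeff_monomial_poly -/(exponents m).
  by case: ifP => _; rewrite ?mulr1 ?mulr0.
rewrite (eq_bigr _ (fun l _ => E l)) -big_mkcondr /=.
case: eqP => [mn|mn] /=; last first.
  rewrite big_pred0 // => l; apply/negP => /andP[_ /perm_sumn].
  by rewrite sumn_exponents; have /and3P[_ _ /eqP ->] := intpartnP l.
have := exponents_is_intpartn m; rewrite mn => /intpartn_exists[l0 l0E].
have pl0 : perm_eq (exponents m) l0 by rewrite l0E perm_sym perm_sort.
rewrite (perm_size pl0); case: ifP => Pl0; last first.
  rewrite big_pred0 // => l; apply/andP => -[Pl /perm_size].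
  by rewrite (perm_size pl0) => E0; rewrite E0 Pl in Pl0.
rewrite (big_pred1 l0) // => l; apply/andP/eqP => [[_ pl]|->//].
have /and3P[sl _ _] := intpartnP l; have /and3P[sl0 _ _] := intpartnP l0.
apply/parts_inj/sorted_geq_perm_eq => //.
by rewrite (perm_trans _ pl0) // perm_sym.
Qed.

Section MonomialCoefficient.
Local Open Scope nat_scope.
Variables (n N a : nat).
Implicit Types (m : 'X_{1..N}).

Lemma sum_word_pairs m : a < n -> (n - a = 1 -> n = 1) ->
  \sum_(s : 'S_n | cycle_type s == [:: n])
    \sum_(t : 'S_n | cycle_type t == hook_type n a)
      \sum_(f : {ffun 'I_n -> 'I_N} | [forall i, f ((s * t)%g i) == f i])
        (content f == m) =
  \sum_(f : {ffun 'I_n -> 'I_N} | content f == m)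
    \sum_(A : {set 'I_n} | #|A| == n - a) \sum_(t | cyclic_on A t)
      \sum_(s | cyclic_on setT s) matching setT f (fun z => f (t z)) s.
Proof.
move=> an hn.
have long (F : 'S_n -> nat) : \sum_(s : 'S_n | cycle_type s == [:: n]) F s =
    \sum_(s | cyclic_on setT s) F s.
  have n0 : 0 < n by lia.
  have := sum_hook_type F n0; rewrite /hook_type subn0 /= => -> //.
  rewrite (big_pred1 setT) // => A; rewrite -[n in _ == n]card_ord -cardsT.
  by apply/eqP/eqP => [An|->//]; apply/eqP; rewrite eqEcard subsetT An /=.
rewrite exchange_big /= sum_hook_type // [RHS]exchange_big /=.
apply: eq_bigr => A _; rewrite [RHS]exchange_big /=; apply: eq_bigr => t _.
(* Replacing [s] by its inverse turns invariance of [f] under [s * t] into the matching of [s] with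
   [t]. *)
rewrite long (reindex_inj invg_inj) [RHS]exchange_big /=.
apply: eq_big => s; first exact: cyclic_onV.
move=> _; rewrite big_mkcond [RHS]big_mkcond /=; apply: eq_bigr => f _.
rewrite (_ : [forall i, _] = matching setT f (fun z => f (t z)) s).
  by case: (content f == m); case: matching.
apply/forallP/forall_inP => [inv z _|mt i].
  by have := inv (s z); rewrite permM permK eq_sym.
by rewrite permM; have := mt (s^-1 i)%g; rewrite permKV inE eq_sym; apply.
Qed.

Lemma card_im_content (f : {ffun 'I_n -> 'I_N}) m : content f = m ->
  #|f @: setT| = size (exponents m).
Proof.
move=> <-; rewrite size_exponents; apply: eq_card => v.
by rewrite inE mnmE fiber_imset cards_eq0.
Qed.

End MonomialCoefficient.

(** All colourings of content [m] contribute equally, and their multinomial number cancels both [n!]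
    and the product of factorials. Where the subtraction in the denominator truncates, the binomial
    is 0. *)
Lemma mcoeff_Fa (C : numFieldType) n a N (m : 'X_{1..N}) :
    (a < n)%N -> ((n - a = 1)%N -> n = 1%N) ->
  (Fa C a n N)@_m = if mdeg m == n then
    ((n - a).-1`! * 'C(n - size (exponents m), a))%:R /
      (n - a - size (exponents m)).+1%:R
  else 0.
Proof.
move=> an hn; rewrite /Fa psi_class_sum_mul.
set S := \sum_(s | _) _; rewrite -[sf_poly _ N]/(n`!%:R^-1 *: sf_eval N S) mcoeffZ.
have -> : (sf_eval N S)@_m = (\sum_(f : {ffun 'I_n -> 'I_N} | content f == m)
    \sum_(A : {set 'I_n} | #|A| == (n - a)%N) \sum_(t | cyclic_on A t)
      \sum_(s | cyclic_on setT s) matching setT f (fun z => f (t z)) s)%N%:R.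
  rewrite -sum_word_pairs // /S linear_sum raddf_sum natr_sum; apply: eq_bigr => s _.
  rewrite linear_sum raddf_sum natr_sum; apply: eq_bigr => t _ /=.
  rewrite -[sf_eval N _]/(powersum C (cycle_type (s * t)%g) N) powersum_cycle_type.
  by rewrite raddf_sum natr_sum; apply: eq_bigr => f _; exact: mcoeff_word_poly.
have degc (f : {ffun 'I_n -> 'I_N}) : mdeg (content f) = n.
  rewrite mdegE -[RHS]card_ord -sum1_card (partition_big f xpredT) //=.
  apply: eq_bigr => v _; rewrite mnmE -sum1_card.
  by apply: eq_bigl => i; rewrite inE in_setT.
case: eqP => [mn|mn]; last first.
  rewrite big_pred0 ?mulr0 // => f; apply/eqP => fm.
  by case: mn; rewrite -fm degc.
set D := (_.-1`! * _)%N; set d := (_ - size _).+1.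
have d0 : d%:R != 0 :> C by rewrite Num.Theory.pnatr_eq0.
have n0 : n`!%:R != 0 :> C by rewrite Num.Theory.pnatr_eq0 -lt0n fact_gt0.
apply: (mulIf d0); rewrite divfK // -mulrA -natrM.
apply: (mulfI n0); rewrite mulVKf // big_distrl /=.
rewrite (eq_bigr (fun=> \prod_v (m v)`! * D)%N) => [|f /eqP fm]; last first.
  have kn : (0 < n - a <= #|'I_n|)%N by rewrite card_ord; lia.
  have := card_cyclic_pairs f kn; rewrite (card_im_content fm) card_ord.
  rewrite subKn; last exact: ltnW.
  move=> ->; congr (_ * _)%N; apply: eq_bigr => v _.
  by rewrite -fm mnmE.
rewrite sum_nat_const !natrM mulrA; congr (_ * _).
rewrite -(mcoeff_sumX_exp C mn) sumX_exp_words raddf_sum /=; congr (_ * _).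
rewrite (eq_bigr _ (fun f _ => mcoeff_word_poly C f m)) -natr_sum; congr (_%:R).
by rewrite -sum1_card [LHS]big_mkcond.
Qed.

Lemma bin_falling (C : numFieldType) (x a : nat) :
  'C(x, a)%:R / (x - a).+1%:R =
  if (a <= x)%N then a`!%:R^-1 * falling x%:R (a%:Z - 1) else 0 :> C.
Proof.
case: leqP => [ax|xa]; last by rewrite bin_small // mul0r.
have a0 : a`!%:R != 0 :> C by rewrite Num.Theory.pnatr_eq0 -lt0n fact_gt0.
have d0 : (x - a).+1%:R != 0 :> C by rewrite Num.Theory.pnatr_eq0.
apply: (mulfI a0); apply: (mulIf d0); rewrite mulVKf // mulrA divfK //.
rewrite mulrC -natrM bin_ffact.
(* For positive [a] the denominator cancels the last factor of the falling factorial; for [a = 0] it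
   is the convention for the falling power at -1. *)
case: a ax {a0} d0 => [|a] ax d0.
  rewrite ffactn0 subn0 (_ : 0%N%:Z - 1 = Negz 0) //= big_ord1 natr1 mulVf //.
  by rewrite -(subn0 x).
rewrite (_ : a.+1%:Z - 1 = a) /=; last by rewrite -addn1 PoszD addrK.
rewrite ffact_prod big_ord_recr /= natrM natr_prod; congr (_ * _%:R); last by lia.
by apply: eq_bigr => i _; rewrite natrB //; have := ltn_ord i; lia.
Qed.

(** Both sides are compared coefficientwise in every number of variables. [hook_nontriv] excludes
    [n - a = 1 < n], where the right-hand side is [n] times [Fa]: it counts the identity once per
    singleton. *)
Theorem theorem4p4 (R : realType) (n a : nat) (n_gt0 : (0 < n)%N)
  (a_lt_n : (a < n)%N) (hook_nontriv : (n - a = 1)%N -> n = 1%N) :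
  Fa R[i] a n =
  ((n - a - 1)`!%:R / a`!%:R) *:
    \sum_(l : intpartn n | (a <= sumn l - size l)%N)
      falling ((sumn l)%:R - (size l)%:R) (a%:Z - 1) *: monomial R[i] l.
Proof.
have sumE (l : intpartn n) : sumn l = n by have /and3P[_ _ /eqP] := intpartnP l.
have sizeE (l : intpartn n) : (size l <= n)%N by rewrite size_map size_bseq.
pose c k : R[i] := falling (n - k)%:R (a%:Z - 1).
rewrite (_ : \sum_(l | _) _ =
    \sum_(l : intpartn n | (a <= n - size l)%N) c (size l) *: monomial R[i] l);
  last first.
  by apply: eq_big => l; rewrite sumE // /c natrB.
apply/symfunP => N; apply/mpolyP => m; rewrite mcoeff_Fa //.
set S := \sum_(l | _) _; rewrite -[X in _ = X@_m]/(_ *: S N) mcoeffZ.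
rewrite /S (mcoeff_monomial_sum n (fun k => a <= n - k)%N c m).
case: eqP => [mn|_] /=; last by rewrite mulr0.
(* Exchanging the two subtractions makes [n - size (exponents m)] the argument of the falling
   power. *)
rewrite natrM subn1 subnAC -mulrA bin_falling /c.
by case: ifP => _; rewrite ?mulr0 // mulrA.
Qed.
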